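(* Let $A\in\mathbb{R}^{n\times n}$ be diagonalizable with eigenvalues (counted with multiplicity) satisfying $|\lambda_1|>|\lambda_2|\ge\cdots\ge|\lambda_n|$, and let $\{\phi_l\}_{l=1}^n$ be a basis of eigenvectors, $A\phi_l=\lambda_l\phi_l$. Let $u_0=\sum_{l=1}^n a_l\phi_l\in\mathbb{R}^n$ with $a_1\neq 0$, and run the dynamic momentum algorithm (defined in the context) with $v_0=u_0$, producing $x_k$, $\nu_k$ and $\beta_k$. Assume that no $\beta_k$, $k\ge 2$, is equal to $\lambda^2/4$ for an eigenvalue $\lambda$ of $A$. Then the following hold, with $A^{(j)}$, $\mu_l^{(j)}$, $\psi_l^{(j)}$ and $\delta_{l,i,k}=\mu_l^{(i)}-\mu_l^{(k)}$ as in the context. (1) If $A$ is symmetric, then $\beta_k<\lambda_1^2/4$ for all $k$. (2) For every $j\ge 1$ there are finite (possibly empty) families $\mathcal{S}_i$ ($1\le i\le j-1$) and $\mathcal{T}_i$ ($1\le i\le j$), whose members are pairs $(\kappa,\pi)$ with $\kappa=(\kappa_1,\dots,\kappa_{j-i})\in\{1,\dots,j\}^{j-i}$ and $\pi=((p_1,q_1),\dots,(p_i,q_i))$, $p_s,q_s\in\{0,\dots,j\}$, and which do not depend on $l$, such that, writing $$M_l(\kappa)=\prod_{s=1}^{j-i}\mu_l^{(\kappa_s)},\qquad R_l(\kappa)=\prod_{s=1}^{j-i}\frac{\mu_l^{(\kappa_s)}}{\mu_1^{(\kappa_s)}},\qquad D_l(\pi)=\prod_{s=1}^{i}\delta_{l,p_s,q_s},$$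 one has $$A^{(j)}A^{(j-1)}\cdots A^{(0)}\begin{pmatrix}u_0\\0\end{pmatrix}= a_1\left(\prod_{i=1}^j\mu_1^{(i)}\right)\left\{\psi_1^{(j)}+\sum_{l=2}^n\frac{a_l}{a_1}\left(\prod_{i=1}^j\frac{\mu_l^{(i)}}{\mu_1^{(i)}}\right)\psi_l^{(j)}\right\}$$ $$+\sum_{i=1}^{j-1}\sum_{(\kappa,\pi)\in\mathcal{S}_i}a_1M_1(\kappa)\left\{D_1(\pi)\psi_1^{(j)}+\sum_{l=2}^n\frac{a_l}{a_1}D_l(\pi)R_l(\kappa)\psi_l^{(j)}\right\}$$ $$+\sum_{i=1}^{j}\sum_{(\kappa,\pi)\in\mathcal{T}_i}a_1M_1(\kappa)\left\{D_1(\pi)\psi_1^{(0)}+\sum_{l=2}^n\frac{a_l}{a_1}D_l(\pi)R_l(\kappa)\psi_l^{(0)}\right\}.$$ (3) If $A$ is symmetric, the algorithm converges to the dominant eigenpair of $A$: as $k\to\infty$, $\mathrm{dist}(\mathrm{span}\{x_k\},\mathrm{span}\{\phi_1\})\to 0$ and $\nu_k\to\lambda_1$.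
   Context: $\|\cdot\|$ and $(\cdot,\cdot)$ are the Euclidean norm and inner product. $\mathrm{dist}$ is the usual distance between subspaces (for lines, the sine of the angle between them). Dynamic momentum algorithm (run indefinitely, i.e. without the stopping tolerance, and assuming the quantities $h_k,d_k$ it divides by are nonzero). Choose $v_0\ne0$, set $h_0=\|v_0\|$, $x_0=h_0^{-1}v_0$, $v_1=Av_0$. For $k=0,1$ (two power iterations): $h_{k+1}=\|v_{k+1}\|$, $x_{k+1}=h_{k+1}^{-1}v_{k+1}$, $v_{k+2}=Ax_{k+1}$, $\nu_{k+1}=(v_{k+2},x_{k+1})$, $d_{k+1}=\|v_{k+2}-\nu_{k+1}x_{k+1}\|$. Set $r_2=\min\{d_2/d_1,1\}$. For $k\ge 2$: $\beta_k=\nu_k^2r_k^2/4$; $u_{k+1}=v_{k+1}-(\beta_k/h_k)x_{k-1}$; $h_{k+1}=\|u_{k+1}\|$; $x_{k+1}=h_{k+1}^{-1}u_{k+1}$; $v_{k+2}=Ax_{k+1}$; $\nu_{k+1}=(v_{k+2},x_{k+1})$; $d_{k+1}=\|v_{k+2}-\nu_{k+1}x_{k+1}\|$; $\rho_k=\min\{d_{k+1}/d_k,1\}$; $r_{k+1}=2\rho_k/(1+\rho_k^2)$. Put $\beta_0=\beta_1=0$ (the two preliminary power iterations). Augmented matrices: $A^{(j)}=\begin{pmatrix}A&-\beta_jI\\ I&0\end{pmatrix}\in\mathbb{R}^{2n\times 2n}$, $j\ge0$ (so $A^{(0)}$ has $\beta_0=0$). For each eigenvalue $\lambda_l$ of $A$,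 $\mu_l^{(j)}$ denotes the root of $\mu^2-\lambda_l\mu+\beta_j=0$ of larger magnitude (if the two roots form a nonreal conjugate pair, the one with positive imaginary part; in any remaining tie, either one, fixed once and for all); it is an eigenvalue of $A^{(j)}$. In particular $\mu_l^{(0)}=\lambda_l$. Its eigenvector is $\psi_l^{(j)}=\begin{pmatrix}\mu_l^{(j)}\phi_l\\ \phi_l\end{pmatrix}$. *)

(* Defs.v *)
From HB Require Import structures.
From mathcomp Require Import all_boot all_order all_algebra.
From mathcomp Require Import complex.
From mathcomp Require Import all_classical all_reals all_analysis.

Set Implicit Arguments.
Unset Strict Implicit.
Unset Printing Implicit Defensive.

Import Order.TTheory GRing.Theory Num.Theory.
Import numFieldNormedType.Exports.

Local Open Scope ring_scope.

(* The matrix [A] and all the quantities computed by the algorithm are real;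
   eigenvalues, eigenvectors and expansion coefficients live in [R[i]]. *)

(* The norm that the library puts on ['cV[R]_n] is the sup norm, whence a
   separate Euclidean norm. *)
Definition edot (R : realType) (n : nat) (x y : 'cV[R]_n) : R :=
  \sum_(i < n) x i 0 * y i 0.

Definition enorm (R : realType) (n : nat) (x : 'cV[R]_n) : R :=
  Num.sqrt (edot x x).

Definition complexify (R : realType) (m n : nat) (M : 'M[R]_(m, n)) :
    'M[R[i]]_(m, n) := map_mx (real_complex R) M.

(* Angle between the complex lines spanned by the nonzero vectors [x] and [y];
   [dotmx] is the Hermitian inner product of row vectors.  The argument of
   [acos] is |<x,y>| / (||x|| ||y||). *)
Definition line_angle (R : realType) (n : nat) (x y : 'cV[R[i]]_n) : R :=
  acos (ComplexField.Normc.normc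
    (dotmx x^T y^T / (sqrtC (dotmx x^T x^T) * sqrtC (dotmx y^T y^T)))).

Definition line_dist (R : realType) (n : nat) (x y : 'cV[R[i]]_n) : R :=
  sin (line_angle x y).

(* The values at small indices that do not occur below ([u] before 3, [nu] and
   [d] at 0, [r] and [rho] before 2) are unconstrained. *)
Record dynamic_momentum (R : realType) (n : nat) (A : 'M[R]_n) (v0 : 'cV[R]_n)
    (h : nat -> R) (x v u : nat -> 'cV[R]_n) (nu d r rho beta : nat -> R) :
    Prop := DynamicMomentum {
  dm_v0_neq0 : v0 != 0;
  dm_v0 : v 0%N = v0;
  dm_h0 : h 0%N = enorm v0;
  dm_x0 : x 0%N = (h 0%N)^-1 *: v0;
  dm_v1 : v 1%N = A *m v0;
  dm_beta0 : beta 0%N = 0;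
  dm_beta1 : beta 1%N = 0;
  dm_power_h : forall k : nat, (k < 2)%N -> h k.+1 = enorm (v k.+1);
  dm_power_x : forall k : nat, (k < 2)%N ->
    x k.+1 = (h k.+1)^-1 *: v k.+1;
  dm_r2 : r 2%N = Num.min (d 2%N / d 1%N) 1;
  dm_beta : forall k : nat, (2 <= k)%N ->
    beta k = nu k ^+ 2 * r k ^+ 2 / 4;
  dm_u : forall k : nat, (2 <= k)%N ->
    u k.+1 = v k.+1 - (beta k / h k) *: x k.-1;
  dm_h : forall k : nat, (2 <= k)%N -> h k.+1 = enorm (u k.+1);
  dm_x : forall k : nat, (2 <= k)%N -> x k.+1 = (h k.+1)^-1 *: u k.+1;
  dm_rho : forall k : nat, (2 <= k)%N ->
    rho k = Num.min (d k.+1 / d k) 1;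
  dm_r : forall k : nat, (2 <= k)%N ->
    r k.+1 = 2 * rho k / (1 + rho k ^+ 2);
  dm_v : forall k : nat, v k.+2 = A *m x k.+1;
  dm_nu : forall k : nat, nu k.+1 = edot (v k.+2) (x k.+1);
  dm_d : forall k : nat, d k.+1 = enorm (v k.+2 - nu k.+1 *: x k.+1)
}.

Definition augmented (R : realType) (n : nat) (A : 'M[R]_n) (b : R) :
    'M[R]_(n + n) := block_mx A (- b%:M) 1%:M 0.

(* A^(j) A^(j-1) ... A^(0), the factor of index 0 being applied first. *)
Fixpoint augmented_prod (R : realType) (n : nat) (A : 'M[R]_n)
    (beta : nat -> R) (j : nat) : 'M[R]_(n + n) :=
  if j is j'.+1 then
    augmented A (beta j'.+1) *m augmented_prod A beta j'
  else augmented A (beta 0%N).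

(* [mu] is the selected root of X^2 - lam X + b: the other root [mu'] (with
   multiplicity) is not larger in modulus, and if the two roots are a nonreal
   conjugate pair then [mu] is the one in the upper half-plane.  Any other tie
   leaves both roots admissible. *)
Definition selected_root (R : realType) (lam b mu : R[i]) : Prop :=
  exists mu' : R[i],
    [/\ 'X^2 - lam *: 'X + b%:P = ('X - mu%:P) * ('X - mu'%:P),
        `|mu'| <= `|mu| &
        (mu \isn't Num.real -> mu' = Num.conj mu -> 0 < complex.Im mu)].

Definition psi (R : realType) (n : nat) (mu : R[i]) (phi : 'cV[R[i]]_n) :
    'cV[R[i]]_(n + n) := col_mx (mu *: phi) phi.

Definition index_pair : Type := (seq nat * seq (nat * nat))%type.

Definition admissible (j i : nat) (kp : index_pair) : bool :=
  [&& size kp.1 == (j - i)%N,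
      all (fun s => (1 <= s <= j)%N) kp.1,
      size kp.2 == i &
      all (fun pq => (pq.1 <= j)%N && (pq.2 <= j)%N) kp.2].

Definition Mprod (R : realType) (I : Type) (mu : nat -> I -> R[i])
    (l : I) (kappa : seq nat) : R[i] := \prod_(s <- kappa) mu s l.

Definition Rprod (R : realType) (I : Type) (mu : nat -> I -> R[i])
    (l1 l : I) (kappa : seq nat) : R[i] :=
  \prod_(s <- kappa) (mu s l / mu s l1).

Definition Dprod (R : realType) (I : Type) (mu : nat -> I -> R[i])
    (l : I) (pi : seq (nat * nat)) : R[i] :=
  \prod_(pq <- pi) (mu pq.1 l - mu pq.2 l).

(* Main.v *)
Require Import Defs.
From HB Require Import structures.
From mathcomp Require Import all_boot all_order all_algebra.
From mathcomp Require Import complex.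
From mathcomp Require Import all_classical all_reals all_analysis.
From mathcomp Require Import spectral.
From mathcomp Require Import ring lra.

Set Implicit Arguments.
Unset Strict Implicit.
Unset Printing Implicit Defensive.

Import Order.TTheory GRing.Theory Num.Theory.
Import numFieldNormedType.Exports.

Local Open Scope classical_set_scope.
Local Open Scope ring_scope.

(** Why the theorem is true.

    The upper block of the product of the augmented matrices applied to
    (u0, 0) is the momentum iteration without normalisation, which splits along
    the eigenvectors of A: the component along an eigenvector of eigenvalue z
    is multiplied by the solution p_k(z) of
      p_0 = 1,  p_1 = z,  p_(k+2) = z p_(k+1) - beta_(k+1) p_k
    ([momentum_factor], [run_spectral]).

    The bound on beta.  A unit vector x with Rayleigh quotient nu satisfies
    |A x - nu x|^2 = |A x|^2 - nu^2, and |A x| <= |lambda_1| for a symmetric A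
    by the spectral theorem.  Since d_k is nonzero, nu_k^2 < lambda_1^2; since
    r_k lies in [0, 1], beta_k < lambda_1^2 / 4 ([run_beta_bounds]).

    The expansion.  If mu^2 - lambda mu + b = 0 then, for every m,
      A_b psi(m) = mu psi(mu) + (m - mu) psi(lambda),
    and psi(lambda) is psi^(0) ([augmented_psi]).  The span of psi^(j) and
    psi^(0) is therefore mapped into the span of psi^(j+1) and psi^(0), and the
    two coefficients obey a linear recursion whose entries are the products
    recorded by [expansion_indices]; the index l enters only through the
    numbers mu_l.

    Convergence.  It rests on 0 <= beta_k <= lambda_1^2 / 4.  Let
    s_k = p_k(z) / p_k(lambda_1) and L = z / lambda_1, so that |L| < 1.
    Dividing the recurrence by p_(k+2)(lambda_1) turns it into
      s_(k+2) = L s_(k+1) + alpha_k (L s_(k+1) - s_k),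
    where comparing p_k(lambda_1) with the extreme case
    beta = lambda_1^2 / 4, in which p_k(lambda_1) is
    (k + 1) (lambda_1 / 2)^k, gives 0 <= alpha_k <= (k + 1) / (k + 3)
    ([momentum_factor_growth]).  With w_k = s_k - L s_(k+1), the energy
      E_k = w_k^2 + (1 - L^2) s_(k+1)^2
    satisfies E_(k+1) = E_k - (1 - alpha_k^2) w_k^2, and w_k, w_(k+1) cannot
    both be small compared with E_k.  Over two steps E therefore loses a
    fraction of at least const / k of its value, and the divergence of the
    harmonic series drives it to 0 ([heavy_ball_cvg0],
    [harmonic_decay_cvg0]).

    For a symmetric A the eigenvector phi_1 is orthogonal to the others, so
    the unit vector x_k is c phi_1 + g with g orthogonal to phi_1 and |g|
    tending to 0 ([run_error_cvg0]).  The sine of the angle is exactly |g|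
    ([line_dist_orthogonal]) and |nu_k - lambda_1| <= 2 |lambda_1| |g|
    ([rayleigh_error]). *)

(** * Heavy-ball recurrences with harmonic damping *)

(** By induction F_k (1 + c H_k) <= F_0, where H_k is the harmonic partial sum:
    (1 - x) (1 + S + x) <= 1 + S for x, S >= 0.  As H_k is unbounded, F has
    arbitrarily small values, and it is nonincreasing. *)
Lemma harmonic_decay_cvg0 (R : realType) (F : nat -> R) (c : R) :
  0 < c -> (forall k, 0 <= F k) ->
  (forall k, F k.+1 <= (1 - c * harmonic k) * F k) -> F @ \oo --> (0 : R).
Proof.
move=> c_gt0 F_ge0 F_decay.
have step_ge0 k : 0 <= c * harmonic k :> R.
  by apply: mulr_ge0; [exact: ltW|exact: harmonic_ge0].
have F_noninc k m : F (k + m)%N <= F k.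
  elim: m => [|m IHm]; first by rewrite addn0.
  rewrite addnS (le_trans (F_decay _)) // (le_trans _ IHm) //.
  by rewrite ler_piMl // gerBl.
have sum_ge0 k : 0 <= series harmonic k :> R.
  by rewrite /series /=; apply: sumr_ge0 => i _; exact: harmonic_ge0.
have F_bound k : F k * (1 + c * series harmonic k) <= F 0%N.
  elim: k => [|k IHk]; first by rewrite /series /= big_geq // mulr0 addr0 mulr1.
  have -> : series harmonic k.+1 = series harmonic k + harmonic k :> R.
    by rewrite /series /= big_nat_recr.
  apply: le_trans IHk; apply: le_trans (ler_wpM2r _ (F_decay k)) _.
    by rewrite mulrDr addrA addr_ge0 // addr_ge0 // mulr_ge0 // ltW.
  have := mulr_ge0 (ltW c_gt0) (sum_ge0 k); have := F_ge0 k; have := step_ge0 k.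
  move: (F k) (series _ _) (harmonic k) => f S t t_ge0 f_ge0 S_ge0.
  by rewrite mulrAC mulrC; apply: ler_wpM2l => //; nra.
have FN (e : R) : 0 < e -> exists N, F N < e.
  move=> e_gt0; apply: contrapT => F_large; apply: (@dvg_harmonic R).
  apply: nondecreasing_is_cvgn.
    by apply/nondecreasing_seqP => k; rewrite /series /= big_nat_recr //= lerDl.
  exists (F 0%N / (e * c)) => _ [k _ <-].
  rewrite ler_pdivlMr ?mulr_gt0 //; apply: le_trans (F_bound k).
  have : e <= F k by rewrite leNgt; apply/negP => ?; apply: F_large; exists k.
  have := mulr_ge0 (ltW c_gt0) (sum_ge0 k).
  move: (series _ _) => S ? ?.
  rewrite mulrA mulrC mulrCA mulrA; nra.
apply/cvgr0Pnorm_lt => e e_gt0; have [M FM] := FN e e_gt0.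
near=> k; rewrite ger0_norm //; apply: le_lt_trans FM.
rewrite -(@subnKC M k) //; near: k; exact: nbhs_infty_ge.
Unshelve. all: by end_near.
Qed.

(** The rotation s_(k+2) = 2 lam s_(k+1) - s_k (case alpha = 1) preserves the
    quadratic form s_k^2 - 2 lam s_k s_(k+1) + s_(k+1)^2, and alpha < 1 can only
    decrease it.  This form is the energy E of the proof. *)
Lemma heavy_ball_cvg0 (R : realType) (lam c : R) (alpha s : nat -> R) :
  `|lam| < 1 -> 0 < c ->
  (forall k, 0 <= alpha k <= 1 - c * harmonic k) ->
  (forall k, s k.+2 = lam * s k.+1 + alpha k * (lam * s k.+1 - s k)) ->
  s @ \oo --> (0 : R).
Proof.
move=> lam_lt1 c_gt0 alphaP sS; pose q := 1 - lam ^+ 2.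
have q_gt0 : 0 < q by rewrite subr_gt0 -real_normK ?num_real // expr_lt1.
have q_le1 : q <= 1 by rewrite gerBl sqr_ge0.
pose w k := s k - lam * s k.+1.
pose E k := w k ^+ 2 + q * s k.+1 ^+ 2.
have harm_gt0 k : 0 < harmonic k :> R by rewrite /harmonic /= invr_gt0.
have harmS k : harmonic k <= 2 * harmonic k.+1 :> R.
  rewrite /harmonic /= ler_pdivlMr // mulrC ler_pdivrMr //.
  by rewrite ?mul1r ?mulr1 -?natrM ler_nat; rewrite mul2n -addnn addSnnS leq_addl.
have ES k : E k.+1 <= E k - c * harmonic k * w k ^+ 2.
  have -> : E k.+1 = E k - (1 - alpha k ^+ 2) * w k ^+ 2.
    by rewrite /E /w sS /q; ring.
  have /andP[a_ge0 a_le] := alphaP k.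
  rewrite lerD2l lerN2 ler_wpM2r ?sqr_ge0 //.
  have := mulr_ge0 (ltW c_gt0) (ltW (harm_gt0 k)).
  move: (c * _) (alpha k) a_ge0 a_le; clear => *; nra.
(* Since w_(k+1) = q s_(k+1) + lam alpha_k w_k, the position is controlled by
   two consecutive values of w, and so is the energy. *)
have E_le k : q * E k <= 3 * (w k ^+ 2 + w k.+1 ^+ 2).
  have /andP[a_ge0 a_le] := alphaP k.
  have a_le1 : alpha k <= 1.
    by rewrite (le_trans a_le) // gerBl mulr_ge0 // ltW.
  have la_le1 : (lam * alpha k) ^+ 2 <= 1.
    rewrite exprMn mulr_ile1 ?sqr_ge0 //; last by rewrite expr_le1.
    by rewrite -real_normK ?num_real // expr_le1 // ltW.
  have wS : w k.+1 = q * s k.+1 + lam * alpha k * w k.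
    by rewrite /w sS /q; ring.
  have -> : q * E k = q * w k ^+ 2 + (w k.+1 - lam * alpha k * w k) ^+ 2.
    by rewrite wS /E; ring.
  have := ler_wpM2r (sqr_ge0 (w k)) q_le1.
  have := ler_wpM2r (sqr_ge0 (w k)) la_le1.
  have := sqr_ge0 (w k.+1); have := sqr_ge0 (w k.+1 + lam * alpha k * w k).
  move: (w k) (w k.+1) (lam * alpha k) (q); clear => *; lra.
have E_ge0 k : 0 <= E k by rewrite addr_ge0 ?sqr_ge0 // mulr_ge0 ?sqr_ge0 // ltW.
have E_noninc k : E k.+1 <= E k.
  apply: le_trans (ES k) _; rewrite gerBl.
  by rewrite mulr_ge0 ?sqr_ge0 // mulr_ge0 // ltW.
have ESS k : E k.+2 <= E k - c * q / 6 * harmonic k * E k.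
  have cW_ge0 i : 0 <= c * w i ^+ 2 by rewrite mulr_ge0 ?sqr_ge0 // ltW.
  have ct_ge0 : 0 <= c * harmonic k by rewrite mulr_ge0 // ltW.
  have := ler_wpM2l ct_ge0 (E_le k).
  have := ler_wpM2l (cW_ge0 k.+1) (harmS k).
  have := mulr_ge0 (cW_ge0 k) (ltW (harm_gt0 k)).
  have := ES k; have := ES k.+1.
  move: (E k) (E k.+1) (E k.+2) (w k) (w k.+1) (harmonic k) (harmonic k.+1).
  by move: (c) (q); clear => *; lra.
(* The decrease is known over two steps only; the sum of two consecutive
   energies decreases at each step. *)
have F_cvg0 : (fun k => E k + E k.+1) @ \oo --> (0 : R).
  apply: (@harmonic_decay_cvg0 _ _ (c * q / 12)) => [||k].
  - by rewrite divr_gt0 ?mulr_gt0.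
  - by move=> k; rewrite addr_ge0.
  have cqt_ge0 : 0 <= c * q * harmonic k by rewrite !mulr_ge0 // ltW.
  have := ler_wpM2l cqt_ge0 (E_noninc k); have := ESS k.
  by move: (E k) (E k.+1) (E k.+2) (harmonic k) (c) (q); clear => *; lra.
rewrite -cvg_shiftS; apply/cvgr0Pnorm_lt => e e_gt0.
have qe_gt0 : 0 < q * e ^+ 2 by rewrite mulr_gt0 ?exprn_gt0.
move/cvgr0Pnorm_lt: F_cvg0 => /(_ _ qe_gt0); apply: filterS => k.
rewrite ger0_norm => [F_lt|]; last by apply: addr_ge0.
rewrite -(@ltr_pXn2r _ 2) ?nnegrE ?normr_ge0 ?(ltW e_gt0) //.
rewrite real_normK ?num_real // -(ltr_pM2l q_gt0) (le_lt_trans _ F_lt) //.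
apply: (@le_trans _ _ (E k)); first by rewrite lerDr sqr_ge0.
by rewrite lerDl; apply: E_ge0.
Qed.

(** * The scalar momentum recurrence *)

(** The component along an eigenvector of eigenvalue [z] of the iteration
    y_(k+2) = A y_(k+1) - beta_(k+1) y_k started at y_0, y_1 = A y_0. *)
Fixpoint momentum_factor (F : pzRingType) (beta : nat -> F) (z : F) (k : nat) : F :=
  match k with
  | 0 => 1
  | k1.+1 => match k1 with
             | 0 => z
             | k2.+1 => z * momentum_factor beta z k1
                        - beta k1 * momentum_factor beta z k2
             end
  end.

Lemma momentum_factorSS (F : pzRingType) (beta : nat -> F) (z : F) (k : nat) :
  momentum_factor beta z k.+2 =
  z * momentum_factor beta z k.+1 - beta k.+1 * momentum_factor beta z k.
Proof. by []. Qed.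

(** The ratio tau_k = p_(k+1) / (z p_k) satisfies
    tau_(k+1) = 1 - beta_(k+1) / (z^2 tau_k), and the lower bound is the
    solution of this recursion for the largest admissible coefficient,
    beta = z^2 / 4.  It excludes any cancellation in the dominant component. *)
Lemma momentum_factor_growth (R : realType) (beta : nat -> R) (z : R) (k : nat) :
  z != 0 -> (forall k, 0 <= beta k.+1 <= z ^+ 2 / 4) ->
  momentum_factor beta z k != 0 /\
  k.+2%:R / (2 * k.+1%:R) <=
    momentum_factor beta z k.+1 / (z * momentum_factor beta z k).
Proof.
move=> z_neq0 betaP; elim: k => [|k [Pk_neq0 ratio_ge]].
  by rewrite /= oner_eq0 !mulr1 !divff // pnatr_eq0.
have ratio_gt0 : 0 < momentum_factor beta z k.+1 / (z * momentum_factor beta z k).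
  by apply: lt_le_trans ratio_ge; rewrite divr_gt0 ?mulr_gt0.
have Pk1_neq0 : momentum_factor beta z k.+1 != 0.
  by apply: contraTneq ratio_gt0 => ->; rewrite mul0r ltxx.
split=> //; rewrite momentum_factorSS.
have /andP[b_ge0 b_le] := betaP k.
move: (momentum_factor beta z k) (momentum_factor beta z k.+1) Pk_neq0 Pk1_neq0
  ratio_ge ratio_gt0 => P Q P_neq0 Q_neq0.
have -> : (z * Q - beta k.+1 * P) / (z * Q) =
    1 - beta k.+1 / z ^+ 2 / (Q / (z * P)) by field; rewrite P_neq0 Q_neq0 z_neq0.
move: (Q / _) => ratio ratio_ge ratio_gt0.
have z2_gt0 : 0 < z ^+ 2 by rewrite lt0r sqrf_eq0 z_neq0 sqr_ge0.
have b4 : beta k.+1 / z ^+ 2 <= 1 / 4.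
  by rewrite ler_pdivrMr // mulrC mul1r.
have : beta k.+1 / z ^+ 2 / ratio <= 1 / 4 / (k.+2%:R / (2 * k.+1%:R)).
  apply: ler_pM => //; first by rewrite divr_ge0 // ltW.
    by rewrite invr_ge0 ltW.
  by rewrite lef_pV2 ?posrE // divr_gt0 ?mulr_gt0.
have -> : (k.+3%:R / (2 * k.+2%:R) : R) = 1 - 1 / 4 / (k.+2%:R / (2 * k.+1%:R)).
  have -> : k.+3%:R = k.+2%:R + 1 :> R by rewrite -natr1.
  have -> : k.+2%:R = k.+1%:R + 1 :> R by rewrite -natr1.
  have : 0 < k.+1%:R :> R by [].
  by move: (k.+1%:R) => t t_gt0; field; apply/andP; split; lra.
by move=> ?; rewrite lerD2l lerN2.
Qed.

(** The quotient of the two recurrences is a heavy-ball recurrence of damping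
    alpha_k = 1 / tau_(k+1) - 1 in the notation of [momentum_factor_growth],
    so that alpha_k <= (k + 1) / (k + 3) by that lemma. *)
Lemma momentum_ratio_cvg0 (R : realType) (beta : nat -> R) (z1 z : R) :
  `|z| < `|z1| -> (forall k, 0 <= beta k.+1 <= z1 ^+ 2 / 4) ->
  (fun k => momentum_factor beta z k / momentum_factor beta z1 k) @ \oo
    --> (0 : R).
Proof.
move=> z_lt betaP.
have z1_neq0 : z1 != 0 by rewrite -normr_gt0 (le_lt_trans _ z_lt).
have growth k := momentum_factor_growth k z1_neq0 betaP.
set P := momentum_factor beta z1; set t := momentum_factor beta z.
pose alpha k := z1 * P k.+1 / P k.+2 - 1.
(* The rate 1/2 is admissible: 2 / (k + 3) >= 1 / (2 (k + 1)). *)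
apply: (@heavy_ball_cvg0 _ (z / z1) (1 / 2) alpha) => // [|k|k].
- by rewrite normrM normfV ltr_pdivrMr ?normr_gt0 // mul1r.
- have [P1_neq0 ratio_ge] := growth k.+1; have [P2_neq0 _] := growth k.+2.
  have [P0_neq0 ratio0_ge] := growth k.
  have ratio0_gt0 : 0 < P k.+1 / (z1 * P k).
    by apply: lt_le_trans ratio0_ge; rewrite divr_gt0 ?mulr_gt0.
  have ratio_gt0 : 0 < P k.+2 / (z1 * P k.+1).
    by apply: lt_le_trans ratio_ge; rewrite divr_gt0 ?mulr_gt0.
  have -> : alpha k = (P k.+2 / (z1 * P k.+1))^-1 - 1 by rewrite invf_div.
  apply/andP; split.
    rewrite subr_ge0 -invr1 lef_pV2 ?posrE //.
    have -> : P k.+2 / (z1 * P k.+1) =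
        1 - beta k.+1 / z1 ^+ 2 / (P k.+1 / (z1 * P k)).
      by rewrite /P momentum_factorSS -/P; field; rewrite ?P0_neq0 ?P1_neq0 ?z1_neq0.
    have /andP[b_ge0 _] := betaP k.
    by rewrite gerBl divr_ge0 ?(ltW ratio0_gt0) // divr_ge0 ?sqr_ge0.
  have : (P k.+2 / (z1 * P k.+1))^-1 <= (k.+3%:R / (2 * k.+2%:R))^-1.
    by rewrite lef_pV2 ?posrE // divr_gt0 ?mulr_gt0.
  rewrite lerBlDr => /le_trans; apply; rewrite addrAC -[1 + 1]/2.
  rewrite /harmonic /= invf_div.
  have -> : k.+3%:R = k.+1%:R + 2 :> R by rewrite -natrD addn2.
  have -> : k.+2%:R = k.+1%:R + 1 :> R by rewrite -natr1.
  have : 1 <= k.+1%:R :> R by rewrite ler1n.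
  move: (k.+1%:R) => x; clear => x_ge1.
  have x_gt0 : 0 < x by lra.
  rewrite ler_pdivrMr; last by lra.
  rewrite -(ler_pM2l x_gt0).
  have -> : x * ((2 - 1 / 2 * x^-1) * (x + 2)) = (2 * x - 1 / 2) * (x + 2).
    by field; lra.
  nra.
have [P1_neq0 _] := growth k.+1; have [P2_neq0 _] := growth k.+2.
have [P0_neq0 _] := growth k; rewrite -!/P in P0_neq0 P1_neq0 P2_neq0.
have -> : t k.+2 = z * t k.+1 - beta k.+1 * t k by [].
have bP : beta k.+1 = (z1 * P k.+1 - P k.+2) / P k.
  by rewrite /P momentum_factorSS -/P; field.
by rewrite /alpha bP; field; rewrite P2_neq0 P1_neq0 P0_neq0 z1_neq0.
Qed.

Lemma momentum_factor_morph (R : realType) (beta : nat -> R) (z : R) (k : nat) :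
  momentum_factor (fun i => real_complex R (beta i)) (real_complex R z) k =
  real_complex R (momentum_factor beta z k).
Proof.
suff [] : momentum_factor (fun i => real_complex R (beta i)) (real_complex R z) k =
  real_complex R (momentum_factor beta z k) /\
  momentum_factor (fun i => real_complex R (beta i)) (real_complex R z) k.+1 =
  real_complex R (momentum_factor beta z k.+1) by [].
elim: k => [|k [IHk IHk1]]; first by rewrite /= rmorph1.
by split=> //; rewrite !momentum_factorSS IHk IHk1 rmorphB !rmorphM.
Qed.

Arguments momentum_factor : simpl never.

(** * Selected roots and augmented matrices *)

Lemma selected_rootP (R : realType) (lam b mu : R[i]) :
  selected_root lam b mu ->
  exists mu', [/\ mu + mu' = lam, mu * mu' = b & `|mu'| <= `|mu|].
Proof.
case=> mu' [root_eq mu'_le _]; exists mu'.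
have b_eq : b = mu * mu'.
  move/(congr1 (horner^~ 0)): root_eq.
  by rewrite !(hornerE, expr0n, subrr, mulrNN) oppr0 add0r.
split=> //; move/(congr1 (horner^~ 1)): root_eq; rewrite !hornerE b_eq => root_eq.
by apply/subr0_eq; rewrite -(subrr ((1 - mu) * (1 - mu'))) -{1}root_eq; ring.
Qed.

Lemma selected_root_eq (R : realType) (lam b mu : R[i]) :
  selected_root lam b mu -> mu ^+ 2 = lam * mu - b.
Proof. by move/selected_rootP => [mu' [<- <- _]]; ring. Qed.

(** The selected root has the larger modulus of two roots of sum [lam]. *)
Lemma selected_root_neq0 (R : realType) (lam b mu : R[i]) :
  selected_root lam b mu -> lam != 0 -> mu != 0.
Proof.
move/selected_rootP => [mu' [<- _ mu'_le]]; apply: contra_neq => mu0.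
by move: mu'_le; rewrite mu0 normr0 normr_le0 add0r => /eqP.
Qed.

Lemma selected_root0 (R : realType) (lam mu : R[i]) :
  selected_root lam 0 mu -> mu = lam.
Proof.
move/selected_rootP => [mu' [<- /eqP]]; rewrite mulf_eq0 => /orP[] /eqP -> mu'_le.
  by move: mu'_le; rewrite normr0 normr_le0 add0r => /eqP.
by rewrite addr0.
Qed.

Lemma complexify_augmented (R : realType) (n : nat) (A : 'M[R]_n) (b : R) :
  complexify (augmented A b) =
  block_mx (complexify A) (- (real_complex R b)%:M) 1%:M 0.
Proof.
by rewrite /complexify /augmented map_block_mx map_mx0 map_mx1 map_mxN map_scalar_mx.
Qed.

Lemma complexifyM (R : realType) (m n p : nat) (A : 'M[R]_(m, n)) (B : 'M[R]_(n, p)) :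
  complexify (A *m B) = complexify A *m complexify B.
Proof. exact: map_mxM. Qed.

(** The vector psi(m) differs from the eigenvector psi(mu) by a multiple of
    (phi, 0), which the augmented matrix sends to psi(lam). *)
Lemma augmented_psi (R : realType) (n : nat) (A : 'M[R]_n) (b : R)
    (lam mu m : R[i]) (phi : 'cV[R[i]]_n) :
  complexify A *m phi = lam *: phi -> selected_root lam (real_complex R b) mu ->
  complexify (augmented A b) *m psi m phi =
  mu *: psi mu phi + (m - mu) *: psi lam phi.
Proof.
move=> A_phi /selected_root_eq mu_eq.
rewrite complexify_augmented /psi mul_block_col !scale_col_mx add_col_mx.
congr col_mx; last by rewrite mul1mx mul0mx addr0 -scalerDl addrC subrK.
rewrite -scalemxAr A_phi mulNmx mul_scalar_mx !scalerA -scalerBl -scalerDl.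
by congr (_ *: _); rewrite -[mu * mu]/(mu ^+ 2) mu_eq; ring.
Qed.

(** * Expansion of the product of augmented matrices *)

(** The pairs (kappa, pi) of the coefficients of psi^(j) and of psi^(0), in
    this order, without the main term of indices 1, ..., j.  A step multiplies
    the psi^(j+1) coefficient by mu^(j+1), and the psi^(0) coefficient by the
    difference of the old and the new root; the main term yields the first
    pair of the second list. *)
Fixpoint expansion_indices (j : nat) : seq index_pair * seq index_pair :=
  if j is j'.+1 then
    let: (SS, TT) := expansion_indices j' in
    ([seq (j :: kp.1, kp.2) | kp <- SS ++ TT],
     (iota 1 j', [:: (j', j)]) ::
     [seq (kp.1, (j', j) :: kp.2) | kp <- SS] ++
     [seq (kp.1, (0%N, j) :: kp.2) | kp <- TT])
  else ([::], [::]).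

(** A step adds one entry, either to kappa or to pi, so that the lengths of
    kappa and pi always add up to j. *)
Lemma expansion_indices_admissible (j : nat) :
  all (fun kp => admissible j (size kp.2) kp && (0 < size kp.2 < j)%N)
    (expansion_indices j).1 /\
  all (fun kp => admissible j (size kp.2) kp && (0 < size kp.2 <= j)%N)
    (expansion_indices j).2.
Proof.
elim: j => [//|j] /=; case: (expansion_indices j) => SS TT /= [/allP S_adm /allP T_adm].
have widen_adm k p kp : (k <= p)%N -> all (fun s => 0 < s <= k)%N kp.1 ->
    all (fun s => 0 < s <= p)%N (kp : index_pair).1.
  move=> kp_le; apply: sub_all => s /andP[-> s_le] /=; exact: leq_trans kp_le.
have widen_adm2 k p kp : (k <= p)%N -> all (fun pq => (pq.1 <= k) && (pq.2 <= k))%N kp.2 ->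
    all (fun pq => (pq.1 <= p) && (pq.2 <= p))%N (kp : index_pair).2.
  move=> kp_le; apply: sub_all => s /andP[s1 s2]; apply/andP.
  by split; exact: leq_trans kp_le.
have base kp : kp \in SS ++ TT -> [&& size kp.1 == (j - size kp.2)%N,
    all (fun s => 0 < s <= j.+1)%N kp.1,
    all (fun pq => (pq.1 <= j.+1) && (pq.2 <= j.+1))%N kp.2 & (0 < size kp.2 <= j)%N].
  rewrite mem_cat => /orP[/S_adm|/T_adm] /andP[/and4P[-> k_adm _ p_adm]].
    move=> /andP[-> /ltnW ->] /=.
    by rewrite (widen_adm j) // (widen_adm2 j).
  by move=> ->; rewrite (widen_adm j) // (widen_adm2 j).
have T_step i kp : (i <= j)%N -> kp \in SS ++ TT ->
   (admissible j.+1 (size kp.2).+1 (kp.1, (i, j.+1) :: kp.2)) &&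
   (0 < (size kp.2).+1 <= j.+1)%N.
  move=> i_le /base /and4P[k_size k_adm p_adm /andP[p_gt0 p_le]].
  by rewrite /admissible /= subSS k_size k_adm p_adm (leqW i_le) !eqxx leqnn ltnS p_le.
split.
  rewrite all_map; apply/allP => kp /base /and4P[/eqP k_size k_adm p_adm].
  move=> /andP[p_gt0 p_le] /=.
  by rewrite /admissible /= k_size subSn // !eqxx k_adm p_adm p_gt0 !ltnS p_le leqnn.
rewrite all_cat !all_map /admissible /= subSS subn0 size_iota leqW // leqnn !eqxx /=.
apply/and3P; split.
- rewrite !andbT; apply/allP => s; rewrite mem_iota add1n => /andP[-> s_lt] /=.
  exact: ltnW.
- by apply/allP => kp kpS; apply: T_step; rewrite // mem_cat kpS.
- by apply/allP => kp kpT; apply: T_step; rewrite // mem_cat kpT orbT.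
Qed.

Definition index_weight (R : realType) (I : Type) (mu : nat -> I -> R[i])
    (l : I) (kp : index_pair) : R[i] :=
  Mprod mu l kp.1 * Dprod mu l kp.2.

Lemma sum_col_mx (R : realType) (m n p : nat) (I : finType)
    (F : I -> 'M[R[i]]_(m, p)) (G : I -> 'M[R[i]]_(n, p)) :
  \sum_l col_mx (F l) (G l) = col_mx (\sum_l F l) (\sum_l G l).
Proof.
elim/big_rec3: _ => [|l X Y Z _ ->]; first by rewrite col_mx0.
by rewrite add_col_mx.
Qed.

Lemma Mprod_iotaS (R : realType) (I : Type) (mu : nat -> I -> R[i]) (l : I) (j : nat) :
  Mprod mu l (iota 1 j.+1) = mu j.+1 l * Mprod mu l (iota 1 j).
Proof. by rewrite /Mprod -(addn1 j) iotaD big_cat big_seq1 add1n addn1 mulrC. Qed.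

(** By [augmented_psi] the coefficients c of psi^(j) and e of psi^(0) become
    mu^(j+1) (c + e) and (mu^(j) - mu^(j+1)) c + (mu^(0) - mu^(j+1)) e; the two
    lists of [expansion_indices] follow this recursion. *)
Lemma augmented_prod_expansion (R : realType) (n : nat) (I : finType)
    (A : 'M[R]_n) (lam : I -> R[i]) (phi : I -> 'cV[R[i]]_n)
    (u0 : 'cV[R]_n) (a : I -> R[i]) (beta : nat -> R) (mu : nat -> I -> R[i])
    (j : nat) :
  (forall l, complexify A *m phi l = lam l *: phi l) ->
  complexify u0 = \sum_l a l *: phi l ->
  beta 0%N = 0 ->
  (forall j l, selected_root (lam l) (real_complex R (beta j)) (mu j l)) ->
  complexify (augmented_prod A beta j) *m col_mx (complexify u0) 0 =
  \sum_l a l *: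
    ((Mprod mu l (iota 1 j) +
      \sum_(kp <- (expansion_indices j).1) index_weight mu l kp) *:
       psi (mu j l) (phi l) +
     (\sum_(kp <- (expansion_indices j).2) index_weight mu l kp) *:
       psi (mu 0%N l) (phi l)).
Proof.
move=> A_phi u0E beta0 mu_sel.
have mu0 l : mu 0%N l = lam l.
  by apply: selected_root0; have := mu_sel 0%N l; rewrite beta0.
elim: j => [|j IHj].
  have b0 : - (real_complex R (beta 0%N))%:M = 0 :> 'M[R[i]]_n.
    by rewrite beta0 -scalemx1 scale0r oppr0.
  rewrite /= complexify_augmented b0 mul_block_col.
  rewrite !mul0mx mul1mx !addr0 u0E mulmx_sumr -sum_col_mx; apply: eq_bigr => l _.
  rewrite /Mprod !big_nil addr0 scale1r scale0r addr0 mu0 /psi scale_col_mx.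
  by rewrite -scalemxAr A_phi.
rewrite /= complexifyM -mulmxA {}IHj mulmx_sumr; apply: eq_bigr => l _.
rewrite -scalemxAr; congr (_ *: _).
rewrite mulmxDr -!scalemxAr !(augmented_psi _ (A_phi l) (mu_sel j.+1 l)) -mu0.
case: (expansion_indices j) => SS TT.
rewrite Mprod_iotaS big_cons !big_cat !big_map big_cat /=.
have consl (s : seq index_pair) : \sum_(kp <- s) index_weight mu l (j.+1 :: kp.1, kp.2) =
    mu j.+1 l * \sum_(kp <- s) index_weight mu l kp.
  rewrite mulr_sumr; apply: eq_bigr => kp _.
  by rewrite /index_weight /Mprod big_cons mulrA.
have consr p (s : seq index_pair) :
    \sum_(kp <- s) index_weight mu l (kp.1, (p, j.+1) :: kp.2) =
    (mu p l - mu j.+1 l) * \sum_(kp <- s) index_weight mu l kp.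
  rewrite mulr_sumr; apply: eq_bigr => kp _.
  by rewrite /index_weight /Dprod big_cons mulrCA.
have -> : index_weight mu l (iota 1 j, [:: (j, j.+1)]) =
    Mprod mu l (iota 1 j) * (mu j l - mu j.+1 l).
  by rewrite /index_weight /Dprod big_seq1.
rewrite !consl !consr.
rewrite !scalerDr !scalerA addrACA.
by congr (_ + _); rewrite -scalerDl; congr (_ *: _); ring.
Qed.

(** Used with M and D the products over a pair (kappa, pi), to pull the
    dominant term out of a sum over all eigenvectors. *)
Lemma factor_dominant (F : fieldType) (V : lmodType F) (I : finType) (i0 : I)
    (a M D : I -> F) (v : I -> V) :
  a i0 != 0 -> M i0 != 0 ->
  \sum_l (a l * (M l * D l)) *: v l =
  (a i0 * M i0) *:
    (D i0 *: v i0 + \sum_(l | l != i0) (a l / a i0 * D l * (M l / M i0)) *: v l).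
Proof.
move=> a0 M0; rewrite (bigD1 i0) //= scalerDr scalerA mulrA scaler_sumr.
congr (_ + _); apply: eq_bigr => l _; rewrite scalerA; congr (_ *: _).
by field; rewrite a0 M0.
Qed.

Lemma RprodE (R : realType) (I : Type) (mu : nat -> I -> R[i]) (l1 l : I)
    (kappa : seq nat) :
  Rprod mu l1 l kappa = Mprod mu l kappa / Mprod mu l1 kappa.
Proof. by rewrite /Rprod /Mprod prodf_div. Qed.

(** The lists of [expansion_indices] are flat; this regroups them by the
    length of pi. *)
Lemma sum_by_size (V : nmodType) (m : nat) (s : seq index_pair)
    (F : index_pair -> V) :
  all (fun kp => 0 < size kp.2 < m)%N s ->
  \sum_(kp <- s) F kp =
  \sum_(1 <= i < m) \sum_(kp <- [seq kp <- s | size kp.2 == i]) F kp.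
Proof.
move=> /allP s_size; under [RHS]eq_bigr do rewrite big_filter big_mkcond.
rewrite exchange_big /= big_seq [RHS]big_seq; apply: eq_bigr => kp /s_size kp_size.
rewrite (bigD1_seq (size kp.2)) ?iota_uniq ?mem_index_iota //= eqxx big1 ?addr0 //.
by move=> i /negPf; rewrite eq_sym => ->.
Qed.

Lemma augmented_prod_dominant_expansion (R : realType) (n m : nat)
    (A : 'M[R]_n) (lam : 'I_m.+1 -> R[i]) (phi : 'I_m.+1 -> 'cV[R[i]]_n)
    (u0 : 'cV[R]_n) (a : 'I_m.+1 -> R[i]) (beta : nat -> R)
    (mu : nat -> 'I_m.+1 -> R[i]) (j : nat) :
  (forall l, complexify A *m phi l = lam l *: phi l) ->
  complexify u0 = \sum_l a l *: phi l ->
  beta 0%N = 0 ->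
  (forall j l, selected_root (lam l) (real_complex R (beta j)) (mu j l)) ->
  lam ord0 != 0 -> a ord0 != 0 ->
  let dominant_sum kappa pi p :=
    (a ord0 * Mprod mu ord0 kappa) *:
      (Dprod mu ord0 pi *: psi (mu p ord0) (phi ord0) +
       \sum_(l < m.+1 | l != ord0)
         (a l / a ord0 * Dprod mu l pi * Rprod mu ord0 l kappa) *:
         psi (mu p l) (phi l)) in
  complexify (augmented_prod A beta j) *m col_mx (complexify u0) 0 =
  dominant_sum (iota 1 j) [::] j +
  \sum_(kp <- (expansion_indices j).1) dominant_sum kp.1 kp.2 j +
  \sum_(kp <- (expansion_indices j).2) dominant_sum kp.1 kp.2 0%N.
Proof.
move=> A_phi u0E beta0 mu_sel lam0 a0 dominant_sum.
have dominant_sumE kappa pi p : dominant_sum kappa pi p =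
    \sum_l (a l * index_weight mu l (kappa, pi)) *: psi (mu p l) (phi l).
  have M0 : Mprod mu ord0 kappa != 0.
    rewrite /Mprod prodf_seq_neq0; apply/allP => s _.
    exact: selected_root_neq0 (mu_sel s ord0) lam0.
  apply/esym; apply: etrans (@factor_dominant _ _ _ ord0 a (Mprod mu ^~ kappa)
    (Dprod mu ^~ pi) (fun l => psi (mu p l) (phi l)) a0 M0) _.
  congr (_ *: (_ + _)); apply: eq_bigr => l _.
  by rewrite RprodE.
rewrite (augmented_prod_expansion j A_phi u0E beta0 mu_sel).
rewrite (eq_bigr _ (fun kp _ => dominant_sumE kp.1 kp.2 j)).
rewrite (eq_bigr _ (fun kp _ => dominant_sumE kp.1 kp.2 0%N)).
rewrite dominant_sumE exchange_big [X in _ + X]exchange_big -!big_split /=.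
apply: eq_bigr => l _; rewrite -!scaler_suml -!mulr_sumr -scalerDl -mulrDr.
rewrite scalerDr !scalerA /index_weight /Dprod big_nil mulr1.
by congr (_ + _); congr ((_ * _) *: _); apply: eq_bigr => -[].
Qed.

(** * The Hermitian product and the distance of lines *)

(** The Hermitian product of columns; [dotmx] is that of rows. *)
Definition hdot (R : realType) (n : nat) (x y : 'cV[R[i]]_n) : R[i] :=
  dotmx x^T y^T.

Lemma hdotDl (R : realType) (n : nat) (x y z : 'cV[R[i]]_n) :
  hdot (x + y) z = hdot x z + hdot y z.
Proof. by rewrite /hdot linearD linearDl. Qed.

Lemma hdotZl (R : realType) (n : nat) (c : R[i]) (x y : 'cV[R[i]]_n) :
  hdot (c *: x) y = c * hdot x y.
Proof. by rewrite /hdot linearZ linearZl_LR. Qed.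

Lemma hdotC (R : realType) (n : nat) (x y : 'cV[R[i]]_n) :
  hdot x y = Num.conj (hdot y x).
Proof. by rewrite /hdot hermC expr0 mul1r. Qed.

Lemma hdotDr (R : realType) (n : nat) (x y z : 'cV[R[i]]_n) :
  hdot x (y + z) = hdot x y + hdot x z.
Proof.
rewrite hdotC; apply: etrans (congr1 _ (hdotDl y z x)) _; rewrite rmorphD.
by congr (_ + _); apply: esym (hdotC _ _).
Qed.

Lemma hdotZr (R : realType) (n : nat) (c : R[i]) (x y : 'cV[R[i]]_n) :
  hdot x (c *: y) = Num.conj c * hdot x y.
Proof. by rewrite hdotC hdotZl rmorphM /= -hdotC. Qed.

Lemma hdot_ge0 (R : realType) (n : nat) (x : 'cV[R[i]]_n) : 0 <= hdot x x.
Proof. exact: dnorm_ge0. Qed.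

Lemma hdot_gt0 (R : realType) (n : nat) (x : 'cV[R[i]]_n) :
  (0 < hdot x x) = (x != 0).
Proof. by rewrite /hdot dnorm_gt0 trmx_eq0. Qed.

Lemma hdot_suml (R : realType) (n : nat) (I : finType) (P : pred I)
    (x : I -> 'cV[R[i]]_n) (y : 'cV[R[i]]_n) :
  hdot (\sum_(l | P l) x l) y = \sum_(l | P l) hdot (x l) y.
Proof. by rewrite /hdot linear_sum linear_sumlz. Qed.

Lemma hdot_sumr (R : realType) (n : nat) (I : finType) (P : pred I)
    (x : 'cV[R[i]]_n) (y : I -> 'cV[R[i]]_n) :
  hdot x (\sum_(l | P l) y l) = \sum_(l | P l) hdot x (y l).
Proof. by rewrite /hdot linear_sum linear_sumr. Qed.

Lemma conj_real_complex (R : realType) (r : R) :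
  Num.conj (real_complex R r) = real_complex R r.
Proof. by rewrite conj_Creal // complex_real. Qed.

Lemma hdot_complexify (R : realType) (n : nat) (x y : 'cV[R]_n) :
  hdot (complexify x) (complexify y) = real_complex R (edot x y).
Proof.
rewrite /hdot dotmxE mxE rmorph_sum; apply: eq_bigr => i _.
by rewrite !mxE conj_real_complex rmorphM.
Qed.

Lemma normr_real_complex (R : realType) (t : R) :
  `|real_complex R t| = real_complex R `|t|.
Proof. by rewrite normc_def /= expr0n addr0 sqrtr_sqr. Qed.

Lemma complex_ReD (R : realType) (z w : R[i]) :
  complex.Re (z + w) = complex.Re z + complex.Re w.
Proof. by case: z; case: w. Qed.

Lemma complex_ReZ (R : realType) (t : R) (z : R[i]) :
  complex.Re (real_complex R t * z) = t * complex.Re z.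
Proof. by case: z => p q /=; rewrite mul0r subr0. Qed.

Definition hnorm2 (R : realType) (n : nat) (x : 'cV[R[i]]_n) : R :=
  complex.Re (hdot x x).

Lemma hnorm2E (R : realType) (n : nat) (x : 'cV[R[i]]_n) :
  hdot x x = real_complex R (hnorm2 x).
Proof. by rewrite /hnorm2 RRe_real // ger0_real // hdot_ge0. Qed.

Lemma hnorm2_ge0 (R : realType) (n : nat) (x : 'cV[R[i]]_n) : 0 <= hnorm2 x.
Proof. by rewrite -lecR -hnorm2E hdot_ge0. Qed.

Lemma hnorm2_gt0 (R : realType) (n : nat) (x : 'cV[R[i]]_n) :
  (0 < hnorm2 x) = (x != 0).
Proof. by rewrite -ltcR -hnorm2E hdot_gt0. Qed.

Lemma sqr_normc (R : realType) (z : R[i]) :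
  real_complex R (ComplexField.Normc.normc z ^+ 2) = z * Num.conj z.
Proof. by rewrite rmorphXn /= -normCK. Qed.

Lemma hnorm2Z (R : realType) (n : nat) (c : R[i]) (x : 'cV[R[i]]_n) :
  hnorm2 (c *: x) = ComplexField.Normc.normc c ^+ 2 * hnorm2 x.
Proof.
apply: complexI; rewrite -hnorm2E hdotZl hdotZr mulrA -sqr_normc hnorm2E.
by rewrite -rmorphM.
Qed.

Lemma hnorm2D (R : realType) (n : nat) (x y : 'cV[R[i]]_n) :
  hnorm2 (x + y) = hnorm2 x + hnorm2 y + 2 * complex.Re (hdot x y).
Proof.
have hdotE := etrans (hdotDl x y (x + y)) (congr2 +%R (hdotDr x x y) (hdotDr y x y)).
apply: etrans (congr1 (@complex.Re R) hdotE) _; rewrite (hdotC y x) /hnorm2.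
case: (hdot x x) (hdot x y) (hdot y y) => p p' [q q'] [r r'] /=.
by ring.
Qed.

Lemma hnorm2_orthogonal (R : realType) (n : nat) (x y : 'cV[R[i]]_n) :
  hdot x y = 0 -> hnorm2 (x + y) = hnorm2 x + hnorm2 y.
Proof. by move=> xy0; apply: etrans (hnorm2D x y) _; rewrite xy0 mulr0 addr0. Qed.

Lemma hnorm2N (R : realType) (n : nat) (x : 'cV[R[i]]_n) :
  hnorm2 (- x) = hnorm2 x.
Proof.
by rewrite /hnorm2 -scaleN1r hdotZl hdotZr rmorphN1 !mulN1r opprK.
Qed.

Lemma hnorm2_sub_le (R : realType) (n : nat) (x y : 'cV[R[i]]_n) :
  hnorm2 (x - y) <= 2 * (hnorm2 x + hnorm2 y).
Proof.
have dotN : complex.Re (hdot x (- y)) = - complex.Re (hdot x y).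
  by rewrite -scaleN1r hdotZr rmorphN1 mulN1r; case: (hdot x y).
have := hnorm2D x (- y); have := hnorm2N y; rewrite dotN.
move: (x - y) (- y) => z Ny -> ->.
have := hnorm2D x y; have := hnorm2_ge0 (x + y); move: (x + y) => w.
move: (hnorm2 w) (hnorm2 x) (hnorm2 y) (complex.Re _) => s p q t; lra.
Qed.

Lemma hnorm2_CauchySchwarz (R : realType) (n : nat) (x y : 'cV[R[i]]_n) :
  ComplexField.Normc.normc (hdot x y) ^+ 2 <= hnorm2 x * hnorm2 y.
Proof.
have normE : real_complex R (hnorm2 x * hnorm2 y) = hdot x x * hdot y y.
  exact: etrans (rmorphM _ _ _) (congr2 *%R (esym (hnorm2E x)) (esym (hnorm2E y))).
have sqrE : real_complex R (ComplexField.Normc.normc (hdot x y) ^+ 2) = `|hdot x y| ^+ 2.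
  by rewrite normCK sqr_normc.
rewrite -lecR sqrE normE.
exact: (CauchySchwarz (@dotmx _ n) x^T y^T).
Qed.

Lemma normc_ge0 (R : realType) (z : R[i]) : 0 <= ComplexField.Normc.normc z.
Proof. by case: z => p q; apply: sqrtr_ge0. Qed.

(** The sine of the arc cosine of t is sqrt (1 - t^2); the hypothesis on the
    inner product says that t^2 = 1 - q. *)
Lemma line_distE (R : realType) (n : nat) (x y : 'cV[R[i]]_n) (p q : R) :
  hdot x x = 1 -> hdot y y = real_complex R p -> 0 < p -> 0 <= q ->
  ComplexField.Normc.normc (hdot x y) ^+ 2 = (1 - q) * p ->
  line_dist x y = Num.sqrt q.
Proof.
rewrite /hdot => x_unit y_norm p_gt0 q_ge0 xy_norm.
rewrite /line_dist /line_angle x_unit y_norm sqrtC1 mul1r.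
set t := ComplexField.Normc.normc _.
have t2 : t ^+ 2 = 1 - q.
  apply: complexI; rewrite sqr_normc -normCK normrM normfV exprMn exprVn.
  have -> : `|sqrtC (real_complex R p)| ^+ 2 = real_complex R p.
    by rewrite -normrX sqrtCK ger0_norm ?lecR ?ltW.
  rewrite normCK -sqr_normc xy_norm rmorphM mulfK //.
  by rewrite gt_eqF // ltcR.
have t_le1 : t <= 1.
  by rewrite -(@ler_pXn2r _ 2) ?nnegrE ?normc_ge0 // expr1n t2 gerBl.
rewrite sin_acos ?t2 ?subKr //.
by rewrite t_le1 andbT (le_trans _ (normc_ge0 _)) // oppr_le0.
Qed.

(** By Pythagoras, |<x, phi>|^2 / |phi|^2 = |c|^2 |phi|^2 = 1 - |g|^2. *)
Lemma line_dist_orthogonal (R : realType) (n : nat) (c : R[i])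
    (x phi g : 'cV[R[i]]_n) :
  x = c *: phi + g -> phi != 0 -> hdot phi g = 0 -> hnorm2 x = 1 ->
  line_dist x phi = Num.sqrt (hnorm2 g).
Proof.
move=> xE phi_neq0 phi_g x_unit.
have x_phi : hdot x phi = c * hdot phi phi.
  have -> : hdot x phi = hdot (c *: phi) phi + hdot g phi by rewrite xE hdotDl.
  by rewrite (hdotC g phi) phi_g rmorph0 addr0 hdotZl.
have pythagoras : 1 = ComplexField.Normc.normc c ^+ 2 * hnorm2 phi + hnorm2 g.
  have cphi_g : hdot (c *: phi) g = 0 by rewrite hdotZl phi_g mulr0.
  rewrite -(hnorm2Z c phi); apply: etrans (esym x_unit) _.
  exact: etrans (congr1 _ xE) (hnorm2_orthogonal cphi_g).
have x_unit' : hdot x x = 1 by apply: etrans (hnorm2E x) _; rewrite x_unit.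
have phi_gt0 : 0 < hnorm2 phi by rewrite hnorm2_gt0.
apply: (line_distE x_unit' (hnorm2E phi) phi_gt0 (hnorm2_ge0 g)).
rewrite x_phi ComplexField.Normc.normcM exprMn pythagoras addrK.
have -> : ComplexField.Normc.normc (hdot phi phi) = hnorm2 phi.
  by rewrite (hnorm2E phi) /= expr0n addr0 sqrtr_sqr ger0_norm // ltW.
by move: (ComplexField.Normc.normc c) (hnorm2 phi) => s p; ring.
Qed.

Lemma sum_cvg0 (R : realType) (I : Type) (r : seq I) (P : pred I)
    (f : I -> nat -> R) :
  (forall l, P l -> f l @ \oo --> (0 : R)) ->
  (fun k => \sum_(l <- r | P l) f l k) @ \oo --> (0 : R).
Proof.
move=> f_cvg0; elim: r => [|l r IHr].
  by under eq_fun do rewrite big_nil; exact: cvg_cst.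
under eq_fun do rewrite big_cons.
case Pl: (P l) => //.
by have := cvgD (f_cvg0 l Pl) IHr; rewrite (addr0 (0 : R)); apply.
Qed.

(** The squared norm is a quadratic form in the coefficients [s l k] with
    constant entries. *)
Lemma hnorm2_sum_cvg0 (R : realType) (n : nat) (I : finType) (P : pred I)
    (w : I -> 'cV[R[i]]_n) (s : I -> nat -> R) :
  (forall l, P l -> s l @ \oo --> (0 : R)) ->
  (fun k => hnorm2 (\sum_(l | P l) real_complex R (s l k) *: w l)) @ \oo
    --> (0 : R).
Proof.
move=> s_cvg0.
have -> : (fun k => hnorm2 (\sum_(l | P l) real_complex R (s l k) *: w l)) =
  fun k => \sum_(l | P l) \sum_(p | P p)
    s l k * (s p k * complex.Re (hdot (w l) (w p))).
  apply/funext => k; rewrite /hnorm2 hdot_suml.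
  rewrite (big_morph _ (@complex_ReD R) (erefl : complex.Re 0 = 0)).
  apply: eq_bigr => l _; rewrite hdot_sumr.
  rewrite (big_morph _ (@complex_ReD R) (erefl : complex.Re 0 = 0)).
  apply: eq_bigr => p _; rewrite hdotZl hdotZr conj_real_complex.
  by rewrite !complex_ReZ.
apply: sum_cvg0 => l Pl; apply: sum_cvg0 => p Pp.
rewrite -(mul0r (0 * complex.Re (hdot (w l) (w p)))).
apply: cvgM; first exact: s_cvg0.
by apply: cvgMr_tmp; exact: s_cvg0.
Qed.

Lemma edot_sub_scale (R : realType) (n : nat) (c : R) (x y : 'cV[R]_n) :
  edot (x - c *: y) (x - c *: y) =
  edot x x - 2 * c * edot x y + c ^+ 2 * edot y y.
Proof.
rewrite /edot !mulr_sumr -sumrB -big_split /=.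
by apply: eq_bigr => i _; rewrite !mxE; ring.
Qed.

Lemma edot_gt0 (R : realType) (n : nat) (x : 'cV[R]_n) :
  enorm x != 0 -> 0 < edot x x.
Proof. by rewrite /enorm sqrtr_eq0 -ltNge. Qed.

Lemma edot_normalized (R : realType) (n : nat) (x : 'cV[R]_n) :
  enorm x != 0 -> edot ((enorm x)^-1 *: x) ((enorm x)^-1 *: x) = 1.
Proof.
move=> x_neq0; have -> : edot ((enorm x)^-1 *: x) ((enorm x)^-1 *: x) =
    (enorm x)^-2 * edot x x.
  rewrite /edot mulr_sumr; apply: eq_bigr => i _; rewrite !mxE.
  by rewrite expr2 invfM; ring.
rewrite -[X in _ * X]sqr_sqrtr ?(ltW (edot_gt0 x_neq0)) //.
by rewrite mulVf // sqrf_eq0.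
Qed.

(** * Spectral bounds for symmetric matrices *)

Lemma hdot_symmetric (R : realType) (n : nat) (A : 'M[R]_n) (x y : 'cV[R[i]]_n) :
  A^T = A ->
  hdot (complexify A *m x) y = hdot x (complexify A *m y).
Proof.
move=> A_sym; rewrite /hdot !dotmxE !trmx_mul !map_mxM mulmxA.
have A_tr : (complexify A)^T = complexify A by rewrite /complexify map_trmx A_sym.
have A_conj : map_mx Num.conj (complexify A) = complexify A.
  by apply/matrixP => i j; rewrite !mxE conj_real_complex.
by rewrite !A_tr A_conj.
Qed.

Lemma symmetric_eigenvalue_real (R : realType) (n : nat) (A : 'M[R]_n)
    (lam : R[i]) (phi : 'cV[R[i]]_n) :
  A^T = A -> complexify A *m phi = lam *: phi -> phi != 0 ->
  lam = real_complex R (complex.Re lam).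
Proof.
move=> A_sym A_phi phi_neq0; apply/esym/RRe_real; rewrite CrealE.
have := hdot_symmetric phi phi A_sym; rewrite A_phi hdotZl hdotZr.
have dot_neq0 : hdot phi phi != 0 by rewrite gt_eqF // hdot_gt0.
by move/(mulIf dot_neq0)/esym/eqP.
Qed.

Lemma symmetric_eigenvectors_orthogonal (R : realType) (n : nat) (A : 'M[R]_n)
    (r1 r2 : R) (phi1 phi2 : 'cV[R[i]]_n) :
  A^T = A -> complexify A *m phi1 = real_complex R r1 *: phi1 ->
  complexify A *m phi2 = real_complex R r2 *: phi2 -> r1 != r2 ->
  hdot phi1 phi2 = 0.
Proof.
move=> A_sym A_phi1 A_phi2; apply: contra_neq_eq => dot_neq0.
have := hdot_symmetric phi1 phi2 A_sym; rewrite A_phi1 A_phi2 hdotZl hdotZr.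
by rewrite conj_real_complex => /(mulIf dot_neq0) /complexI.
Qed.

(** In a basis of eigenvectors, A v = r v reads (r - lam l) c_l = 0 for every
    coordinate c_l of v, and some coordinate is nonzero. *)
Lemma eigenvalue_of_basis (F : fieldType) (n m : nat) (A : 'M[F]_n)
    (lam : 'I_m -> F) (phi : 'I_m -> 'cV[F]_n) (r : F) (v : 'cV[F]_n) :
  basis_of fullv [tuple phi l | l < m] ->
  (forall l, A *m phi l = lam l *: phi l) ->
  A *m v = r *: v -> v != 0 -> exists l, r = lam l.
Proof.
move=> phi_basis A_phi A_v v_neq0.
have phiE (l : 'I_m) : [tuple phi l | l < m]`_l = phi l by rewrite -tnth_nth tnth_mktuple.
have [c vE] : exists c : 'I_m -> F, v = \sum_l c l *: phi l.
  exists (fun l => coord [tuple phi l | l < m] l v).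
  by rewrite {1}(coord_basis phi_basis (memvf v)); under eq_bigr do rewrite phiE.
apply: contrapT => r_neq; move/negP: v_neq0; apply; apply/eqP.
rewrite vE big1 // => l _; have /freeP free_phi := basis_free phi_basis.
have /eqP : (r - lam l) * c l = 0.
  apply: (free_phi (fun l => (r - lam l) * c l)).
  under eq_bigr do rewrite phiE mulrBl scalerBl -!scalerA.
  rewrite sumrB -scaler_sumr -vE -A_v vE mulmx_sumr.
  apply/eqP; rewrite subr_eq0; apply/eqP; apply: eq_bigr => k _.
  by rewrite -scalemxAr A_phi scalerA mulrC -scalerA.
rewrite mulf_eq0 subr_eq0 => /orP[/eqP r_eq|/eqP ->]; last by rewrite scale0r.
by case: r_neq; exists l.
Qed.

(** The basis phi need not be orthogonal, whence the detour through the
    unitary diagonalisation given by the spectral theorem: its diagonal entries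
    are eigenvalues, hence among the [lam l]. *)
Lemma symmetric_norm_le (R : realType) (n m : nat) (A : 'M[R]_n)
    (lam : 'I_m -> R[i]) (phi : 'I_m -> 'cV[R[i]]_n) (b : R[i])
    (x : 'cV[R[i]]_n) :
  A^T = A -> basis_of fullv [tuple phi l | l < m] ->
  (forall l, complexify A *m phi l = lam l *: phi l) ->
  (forall l, `|lam l| <= b) ->
  hdot (complexify A *m x) (complexify A *m x) <= b ^+ 2 * hdot x x.
Proof.
move=> A_sym phi_basis A_phi lam_le.
have A_tr : (complexify A)^T = complexify A by rewrite /complexify map_trmx A_sym.
have A_herm : complexify A \is hermsymmx.
  apply: realsym_hermsym; first by apply/is_hermitianmxP; rewrite scale1r map_mx_id.
  by apply/mxOverP => i j; rewrite mxE complex_real.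
have /hermitian_normalmx /orthomx_spectralP := A_herm.
set P := spectralmx _; set d := spectral_diag _ => A_diag.
have P_unitary : P \is unitarymx := spectral_unitarymx _.
have P_unit : P \in unitmx := spectral_unit _.
have d_le i : `|d 0 i| <= b.
  have PA : P *m complexify A = diag_mx d *m P.
    by rewrite {1}A_diag !mulmxA mulmxV // mul1mx.
  have [] := @eigenvalue_of_basis _ _ _ _ _ _ (d 0 i) (row i P)^T phi_basis A_phi.
  - by rewrite -{1}A_tr -trmx_mul -row_mul PA row_mul row_diag_mx -scalemxAl -rowE linearZ.
  - rewrite trmx_eq0; apply: contraTneq P_unitary => row0.
    apply/negP => /row_unitarymxP /(_ i i); rewrite row0 linear0l eqxx.
    by move/esym/eqP; rewrite oner_eq0.
  by move=> l ->.
have norm_unitary (u : 'rV[R[i]]_n) : dotmx (u *m P) (u *m P) = dotmx u u.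
  rewrite !dotmxE trmx_mul map_mxM mulmxA -[u *m P *m _]mulmxA.
  by rewrite (unitarymxP P_unitary) mulmx1.
have [u xE] : exists u, x^T = u *m P by exists (x^T *m invmx P); rewrite mulmxKV.
rewrite /hdot trmx_mul A_tr xE A_diag !mulmxA mulmxK // !norm_unitary.
rewrite mul_mx_diag !dotmxE !mxE mulr_sumr; apply: ler_sum => i _.
rewrite !mxE -!normCK normrM exprMn mulrC.
by rewrite ler_wpM2r ?exprn_ge0 // ler_pXn2r ?nnegrE // (le_trans _ (d_le i)).
Qed.

(** Since x is a unit vector, |A x - nu x|^2 = |A x|^2 - nu^2 for nu = (A x, x). *)
Lemma rayleigh_quotient_lt (R : realType) (n m : nat) (A : 'M[R]_n)
    (lam : 'I_m -> R[i]) (phi : 'I_m -> 'cV[R[i]]_n) (b : R) (x : 'cV[R]_n) :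
  A^T = A -> basis_of fullv [tuple phi l | l < m] ->
  (forall l, complexify A *m phi l = lam l *: phi l) ->
  (forall l, `|lam l| <= real_complex R b) ->
  edot x x = 1 -> enorm (A *m x - edot (A *m x) x *: x) != 0 ->
  edot (A *m x) x ^+ 2 < b ^+ 2.
Proof.
move=> A_sym phi_basis A_phi lam_le x_unit /edot_gt0; rewrite edot_sub_scale x_unit.
have := symmetric_norm_le (complexify x) A_sym phi_basis A_phi lam_le.
rewrite -complexifyM !hdot_complexify x_unit rmorph1 !mulr1 -rmorphXn lecR.
by move: (edot _ x) => t; lra.
Qed.

(** As x is a unit vector, nu - lambda = <A x - lambda x, x>, and
    A x - lambda x = A g - lambda g because phi is an eigenvector. *)
Lemma rayleigh_error (R : realType) (n m : nat) (A : 'M[R]_n)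
    (lam : 'I_m -> R[i]) (phi : 'I_m -> 'cV[R[i]]_n) (b : R) (l0 : 'I_m) (c : R[i])
    (g : 'cV[R[i]]_n) (x : 'cV[R]_n) :
  A^T = A -> basis_of fullv [tuple phi l | l < m] ->
  (forall l, complexify A *m phi l = lam l *: phi l) ->
  (forall l, `|lam l| <= real_complex R b) ->
  complexify x = c *: phi l0 + g -> edot x x = 1 ->
  ComplexField.Normc.normc (real_complex R (edot (A *m x) x) - lam l0) ^+ 2 <=
    4 * b ^+ 2 * hnorm2 g.
Proof.
move=> A_sym phi_basis A_phi lam_le xE x_unit.
have x_unit' : hnorm2 (complexify x) = 1.
  by apply: complexI; rewrite -hnorm2E hdot_complexify x_unit.
have [Ag AgE] : exists Ag, Ag = complexify A *m g by exists (complexify A *m g).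
have -> : real_complex R (edot (A *m x) x) - lam l0 =
    hdot (Ag - lam l0 *: g) (complexify x).
  have -> : Ag - lam l0 *: g =
      complexify A *m complexify x - lam l0 *: complexify x.
    rewrite AgE xE mulmxDr scalerDr -scalemxAr A_phi !scalerA mulrC.
    by rewrite opprD addrACA subrr add0r.
  rewrite -complexifyM -scaleNr hdotDl hdotZl !hdot_complexify x_unit rmorph1.
  by rewrite mulr1.
apply: le_trans (hnorm2_CauchySchwarz _ _) _; rewrite x_unit' mulr1.
apply: le_trans (hnorm2_sub_le _ _) _; rewrite hnorm2Z.
have Ag_le : hnorm2 Ag <= b ^+ 2 * hnorm2 g.
  have := symmetric_norm_le g A_sym phi_basis A_phi lam_le.
  by rewrite -AgE (hnorm2E Ag) (hnorm2E g) -rmorphXn -rmorphM lecR.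
have b_ge : ComplexField.Normc.normc (lam l0) ^+ 2 <= b ^+ 2.
  have normc_le : ComplexField.Normc.normc (lam l0) <= b by rewrite -lecR; exact: lam_le.
  have normc_lam_ge0 := normc_ge0 (lam l0).
  by rewrite ler_pXn2r ?nnegrE // (le_trans normc_lam_ge0).
have -> (B G : R) : 4 * B * G = 2 * (B * G + B * G) by ring.
by rewrite ler_pM2l // lerD // ler_wpM2r // hnorm2_ge0.
Qed.

(** * Runs of the momentum algorithm *)

(** The power step producing x_2 is a momentum step too, since beta_1 = 0. *)
Lemma run_step (R : realType) (n : nat) (A : 'M[R]_n) (v0 : 'cV[R]_n)
    (h : nat -> R) (x v u : nat -> 'cV[R]_n) (nu d r rho beta : nat -> R)
    (k : nat) :
  dynamic_momentum A v0 h x v u nu d r rho beta ->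
  x k.+2 = (h k.+2)^-1 *: (A *m x k.+1 - (beta k.+1 / h k.+1) *: x k).
Proof.
move=> run; case: k => [|k].
  rewrite (dm_power_x run) // (dm_v run) (dm_beta1 run) mul0r scale0r subr0 //.
by rewrite (dm_x run) // (dm_u run) // (dm_v run).
Qed.

Lemma run_unit (R : realType) (n : nat) (A : 'M[R]_n) (v0 : 'cV[R]_n)
    (h : nat -> R) (x v u : nat -> 'cV[R]_n) (nu d r rho beta : nat -> R)
    (k : nat) :
  dynamic_momentum A v0 h x v u nu d r rho beta -> h k.+1 != 0 ->
  edot (x k.+1) (x k.+1) = 1.
Proof.
move=> run; case: (ltnP k 2) => k_le h_neq0.
  rewrite (dm_power_x run) // (dm_power_h run) //; apply: edot_normalized.
  by rewrite -(dm_power_h run).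
rewrite (dm_x run) // (dm_h run) //; apply: edot_normalized.
by rewrite -(dm_h run).
Qed.

Lemma run_r_bounds (R : realType) (n : nat) (A : 'M[R]_n) (v0 : 'cV[R]_n)
    (h : nat -> R) (x v u : nat -> 'cV[R]_n) (nu d r rho beta : nat -> R)
    (k : nat) :
  dynamic_momentum A v0 h x v u nu d r rho beta -> (2 <= k)%N -> 0 <= r k <= 1.
Proof.
move=> run; have ratio_bounds i : 0 <= Num.min (d i.+2 / d i.+1) 1 <= 1.
  by rewrite le_min ler01 ge_min lexx orbT !(dm_d run) divr_ge0 ?sqrtr_ge0.
case: k => [|[|[|k]]] // _; first by rewrite (dm_r2 run).
rewrite (dm_r run) // (dm_rho run) //.
have := ratio_bounds k.+1; move: (Num.min _ _) => t /andP[t_ge0 t_le1].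
have den_gt0 : 0 < 1 + t ^+ 2 by rewrite ltr_wpDr ?sqr_ge0.
rewrite divr_ge0 ?mulr_ge0 ?(ltW den_gt0) //= ler_pdivrMr // mul1r.
by have := sqr_ge0 (1 - t); rewrite sqrrB; lra.
Qed.

Lemma run_beta_bounds (R : realType) (n m : nat) (A : 'M[R]_n) (v0 : 'cV[R]_n)
    (lam : 'I_m -> R[i]) (phi : 'I_m -> 'cV[R[i]]_n) (b : R)
    (h : nat -> R) (x v u : nat -> 'cV[R]_n) (nu d r rho beta : nat -> R)
    (k : nat) :
  A^T = A -> basis_of fullv [tuple phi l | l < m] ->
  (forall l, complexify A *m phi l = lam l *: phi l) ->
  0 < b -> (forall l, `|lam l| <= real_complex R b) ->
  dynamic_momentum A v0 h x v u nu d r rho beta ->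
  (forall k : nat, h k != 0) -> (forall k : nat, (1 <= k)%N -> d k != 0) ->
  0 <= beta k < b ^+ 2 / 4.
Proof.
move=> A_sym phi_basis A_phi b_gt0 lam_le run h_neq0 d_neq0.
case: (ltnP k 2) => [|k_ge2].
  have b2_gt0 : 0 < b ^+ 2 / 4 by rewrite divr_gt0 ?exprn_gt0.
  by case: k => [|[|//]] _; rewrite ?(dm_beta0 run) ?(dm_beta1 run) lexx b2_gt0.
rewrite (dm_beta run) //.
have /andP[r_ge0 r_le1] := run_r_bounds run k_ge2.
case: k k_ge2 => [//|k] k_ge2 in r_ge0 r_le1 *.
have nu_lt : nu k.+1 ^+ 2 < b ^+ 2.
  have := d_neq0 k.+1 isT; rewrite (dm_d run) (dm_nu run) (dm_v run).
  by apply: (rayleigh_quotient_lt A_sym phi_basis A_phi lam_le); apply: run_unit run _.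
rewrite divr_ge0 ?(mulr_ge0 (sqr_ge0 _) (sqr_ge0 _)) //= ltr_pM2r ?invr_gt0 //.
apply: le_lt_trans nu_lt; rewrite ler_piMr ?sqr_ge0 //.
by rewrite expr_le1.
Qed.

(** By induction x_k is the k-th iterate y_k of the unnormalised momentum
    iteration divided by h_1 ... h_k; the division of beta_k by h_k in the
    algorithm is what makes the normalisations of x_k and x_(k-1) agree. *)
Lemma run_spectral (R : realType) (n : nat) (I : finType) (A : 'M[R]_n)
    (v0 : 'cV[R]_n) (lam a : I -> R[i]) (phi : I -> 'cV[R[i]]_n)
    (h : nat -> R) (x v u : nat -> 'cV[R]_n) (nu d r rho beta : nat -> R)
    (k : nat) :
  (forall l, complexify A *m phi l = lam l *: phi l) ->
  complexify v0 = \sum_l a l *: phi l ->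
  dynamic_momentum A v0 h x v u nu d r rho beta -> (forall k : nat, h k != 0) ->
  complexify (x k.+1) = real_complex R (\prod_(1 <= i < k.+2) h i)^-1 *:
    \sum_l (a l * momentum_factor (fun i => real_complex R (beta i)) (lam l) k.+1)
             *: phi l.
Proof.
move=> A_phi v0E run h_neq0.
pose y k := \sum_l (a l * momentum_factor (fun i => real_complex R (beta i))
  (lam l) k) *: phi l.
pose c k := real_complex R (\prod_(1 <= i < k.+1) h i)^-1.
have cS i : c i.+1 = real_complex R (h i.+1)^-1 * c i.
  by rewrite /c big_nat_recr //= invfM rmorphM mulrC.
have complexifyZ t (w : 'cV[R]_n) : complexify (t *: w) = real_complex R t *: complexify w.
  exact: map_mxZ.
have Ay i : complexify A *m y i = \sum_l (lam l * (a l * momentum_factor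
    (fun i => real_complex R (beta i)) (lam l) i)) *: phi l.
  rewrite mulmx_sumr; apply: eq_bigr => l _.
  by rewrite -scalemxAr A_phi scalerA mulrC.
have ySS i : y i.+2 = complexify A *m y i.+1 - real_complex R (beta i.+1) *: y i.
  rewrite Ay scaler_sumr -sumrB; apply: eq_bigr => l _.
  by rewrite momentum_factorSS scalerA -scalerBl; congr (_ *: _); ring.
have x1 : complexify (x 1%N) = c 1%N *: y 1%N.
  rewrite (dm_power_x run) // (dm_v1 run) complexifyZ complexifyM.
  rewrite /c big_nat1; congr (_ *: _); rewrite v0E mulmx_sumr.
  by apply: eq_bigr => l _; rewrite -scalemxAr A_phi scalerA.
have x2 : complexify (x 2%N) = c 2%N *: y 2%N.
  rewrite (run_step _ run) (dm_beta1 run) mul0r scale0r subr0 complexifyZ complexifyM.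
  rewrite x1 ySS (dm_beta1 run) rmorph0 scale0r subr0 -scalemxAr scalerA.
  by rewrite (cS 1%N).
rewrite -[RHS]/(c k.+1 *: y k.+1).
suff [] : complexify (x k.+1) = c k.+1 *: y k.+1 /\
  complexify (x k.+2) = c k.+2 *: y k.+2 by [].
elim: k => [//|k [IHk IHk1]]; split=> //.
rewrite (run_step _ run) complexifyZ /complexify map_mxB -!/(complexify _).
rewrite complexifyM complexifyZ IHk IHk1 (ySS k.+1) scalerBr [RHS]scalerBr !scalerA.
rewrite (cS k.+2) (cS k.+1).
congr (_ - _).
  by rewrite -scalemxAr scalerA.
congr (_ *: _).
by rewrite !rmorphM; ring.
Qed.

(** * Convergence of a run *)

(** Write x_(k+1) = t (a_1 phi_1 + e) with e = sum of s_l a_l phi_l over l > 1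
    and s_l the ratio of momentum factors.  The factor t, which collects the
    normalisations, stays bounded: by Pythagoras
    1 = |x|^2 >= t^2 |a_1 phi_1|^2. *)
Lemma run_error_cvg0 (R : realType) (n m : nat) (A : 'M[R]_n) (v0 : 'cV[R]_n)
    (lam : 'I_m.+1 -> R) (a : 'I_m.+1 -> R[i]) (phi : 'I_m.+1 -> 'cV[R[i]]_n)
    (h : nat -> R) (x v u : nat -> 'cV[R]_n) (nu d r rho beta : nat -> R) :
  A^T = A ->
  (forall l, complexify A *m phi l = real_complex R (lam l) *: phi l) ->
  phi ord0 != 0 -> (forall l, l != ord0 -> `|lam l| < `|lam ord0|) ->
  complexify v0 = \sum_l a l *: phi l -> a ord0 != 0 ->
  dynamic_momentum A v0 h x v u nu d r rho beta -> (forall k : nat, h k != 0) ->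
  lam ord0 != 0 -> (forall k : nat, 0 <= beta k <= lam ord0 ^+ 2 / 4) ->
  exists (c : nat -> R[i]) (g : nat -> 'cV[R[i]]_n),
    [/\ forall k, complexify (x k.+1) = c k *: phi ord0 + g k,
        forall k, hdot (phi ord0) (g k) = 0 &
        (fun k => hnorm2 (g k)) @ \oo --> (0 : R)].
Proof.
move=> A_sym A_phi phi0_neq0 lam_lt v0E a0_neq0 run h_neq0 lam0_neq0 beta_le.
pose P l k := momentum_factor beta (lam l) k.
have P0_neq0 k : P ord0 k != 0.
  by have [] := momentum_factor_growth k lam0_neq0 (fun i => beta_le i.+1).
pose s l k := P l k.+1 / P ord0 k.+1.
pose w l := a l *: phi l.
pose e k := \sum_(l | l != ord0) real_complex R (s l k) *: w l.
pose t k := (\prod_(1 <= i < k.+2) h i)^-1 * P ord0 k.+1.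
pose c k := real_complex R (t k) * a ord0.
pose g k := real_complex R (t k) *: e k.
have xE k : complexify (x k.+1) = c k *: phi ord0 + g k.
  rewrite (run_spectral k A_phi v0E run h_neq0) (bigD1 ord0) //= scalerDr.
  congr (_ + _).
    rewrite scalerA momentum_factor_morph; congr (_ *: _).
    by rewrite /c /t rmorphM mulrCA mulrC.
  rewrite /g /e !scaler_sumr; apply: eq_bigr => l _.
  rewrite momentum_factor_morph !scalerA; congr (_ *: _).
  have tsE : t k * s l k = (\prod_(1 <= i < k.+2) h i)^-1 * P l k.+1.
    by rewrite /s /t -mulrA [P ord0 _ * _]mulrC mulfVK.
  by rewrite -(rmorphM _ (t k) (s l k)) tsE rmorphM mulrCA mulrC.
have phi0_w l : l != ord0 -> hdot (phi ord0) (w l) = 0.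
  move=> l_neq0; rewrite hdotZr.
  rewrite (symmetric_eigenvectors_orthogonal A_sym (A_phi ord0) (A_phi l)) ?mulr0 //.
  by apply: contraTneq (lam_lt l l_neq0) => ->; rewrite ltxx.
have phi0_e k : hdot (phi ord0) (e k) = 0.
  rewrite hdot_sumr; apply: big1 => l l_neq0.
  by rewrite hdotZr (phi0_w l l_neq0) mulr0.
exists c, g; split; [exact: xE|move=> k|].
  by rewrite /g hdotZr phi0_e mulr0.
pose K := hnorm2 (w ord0).
have K_gt0 : 0 < K by rewrite hnorm2_gt0 scaler_eq0 negb_or a0_neq0.
have normc_t k : ComplexField.Normc.normc (real_complex R (t k)) ^+ 2 = t k ^+ 2.
  by rewrite /= expr0n addr0 sqrtr_sqr real_normK ?num_real.
have t_le k : t k ^+ 2 <= K^-1.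
  have orth : hdot (c k *: phi ord0) (g k) = 0 by rewrite hdotZl hdotZr phi0_e !mulr0.
  have x_unit : hnorm2 (complexify (x k.+1)) = 1.
    by rewrite /hnorm2 hdot_complexify (run_unit run).
  have : hnorm2 (c k *: phi ord0) + hnorm2 (g k) = 1.
    exact: etrans (esym (hnorm2_orthogonal orth)) (etrans (esym (congr1 _ (xE k))) x_unit).
  have -> : hnorm2 (c k *: phi ord0) = t k ^+ 2 * K.
    by rewrite /c -scalerA hnorm2Z normc_t.
  by move=> sum1; rewrite -[K^-1]mul1r ler_pdivlMr // -sum1 lerDl hnorm2_ge0.
have e_cvg0 : (fun k => K^-1 * hnorm2 (e k)) @ \oo --> (0 : R).
  rewrite -[X in _ --> X](mulr0 K^-1); apply: cvgMl_tmp.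
  apply: hnorm2_sum_cvg0 => l l_neq0.
  have := momentum_ratio_cvg0 (lam_lt l l_neq0) (fun i => beta_le i.+1).
  by rewrite -cvg_shiftS.
apply: squeeze_cvgr (cvg_cst (0 : R)) e_cvg0.
apply: nearW => k; rewrite hnorm2_ge0 hnorm2Z normc_t.
by apply: ler_wpM2r; [exact: hnorm2_ge0|exact: t_le].
Qed.

Theorem theorem3p1 (R : realType) (n : nat) (A : 'M[R]_n.+2)
    (lam : 'I_n.+2 -> R[i]) (phi : 'I_n.+2 -> 'cV[R[i]]_n.+2)
    (phi_basis : basis_of fullv [tuple phi l | l < n.+2])
    (phi_eigen : forall l : 'I_n.+2,
      complexify A *m phi l = lam l *: phi l)
    (lam_dominant : `|lam (lift ord0 ord0)| < `|lam ord0|)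
    (lam_sorted : forall l m : 'I_n.+2, (l <= m)%N -> `|lam m| <= `|lam l|)
    (u0 : 'cV[R]_n.+2) (a : 'I_n.+2 -> R[i])
    (u0_expansion : complexify u0 = \sum_(l < n.+2) a l *: phi l)
    (a1_neq0 : a ord0 != 0)
    (h : nat -> R) (x v u : nat -> 'cV[R]_n.+2) (nu d r rho beta : nat -> R)
    (run : dynamic_momentum A u0 h x v u nu d r rho beta)
    (h_neq0 : forall k : nat, h k != 0)
    (d_neq0 : forall k : nat, (1 <= k)%N -> d k != 0)
    (beta_generic : forall (k : nat) (l : 'I_n.+2), (2 <= k)%N ->
      real_complex R (beta k) != lam l ^+ 2 / 4)
    (mu : nat -> 'I_n.+2 -> R[i])
    (mu_selected : forall (j : nat) (l : 'I_n.+2),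
      selected_root (lam l) (real_complex R (beta j)) (mu j l)) :
  [/\ A^T = A ->
        forall k : nat, real_complex R (beta k) < lam ord0 ^+ 2 / 4,
      forall j : nat, (1 <= j)%N ->
        exists SS TT : nat -> seq index_pair,
          [/\ forall i : nat, (1 <= i <= j.-1)%N -> all (admissible j i) (SS i),
              forall i : nat, (1 <= i <= j)%N -> all (admissible j i) (TT i) &
              complexify (augmented_prod A beta j) *m col_mx (complexify u0) 0 =
                (a ord0 * \prod_(1 <= i < j.+1) mu i ord0) *:
                  (psi (mu j ord0) (phi ord0) +
                   \sum_(l < n.+2 | l != ord0)
                     (a l / a ord0 *
                      \prod_(1 <= i < j.+1) (mu i l / mu i ord0)) *:
                     psi (mu j l) (phi l))
              + \sum_(1 <= i < j) \sum_(kp <- SS i)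
                  (a ord0 * Mprod mu ord0 kp.1) *:
                  (Dprod mu ord0 kp.2 *: psi (mu j ord0) (phi ord0) +
                   \sum_(l < n.+2 | l != ord0)
                     (a l / a ord0 * Dprod mu l kp.2 * Rprod mu ord0 l kp.1) *:
                     psi (mu j l) (phi l))
              + \sum_(1 <= i < j.+1) \sum_(kp <- TT i)
                  (a ord0 * Mprod mu ord0 kp.1) *:
                  (Dprod mu ord0 kp.2 *: psi (mu 0%N ord0) (phi ord0) +
                   \sum_(l < n.+2 | l != ord0)
                     (a l / a ord0 * Dprod mu l kp.2 * Rprod mu ord0 l kp.1) *:
                     psi (mu 0%N l) (phi l))] &
      A^T = A ->
        (line_dist (complexify (x k)) (phi ord0) @[k --> \oo] --> (0 : R)) /\
        (ComplexField.Normc.normc (real_complex R (nu k) - lam ord0)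
           @[k --> \oo] --> (0 : R))].
Proof.
have lam0_neq0 : lam ord0 != 0.
  by rewrite -normr_gt0 (le_lt_trans _ lam_dominant).
have lam_lt l : l != ord0 -> `|lam l| < `|lam ord0|.
  move=> l_neq0; apply: le_lt_trans lam_dominant; apply: lam_sorted.
  by rewrite /= lt0n; apply: contra_neq l_neq0 => l0; apply: val_inj.
have lam_le l : `|lam l| <= `|lam ord0| by apply: lam_sorted.
have phi_neq0 l : phi l != 0.
  have phiE : phi l = [tuple phi l | l < n.+2]`_l by rewrite -tnth_nth tnth_mktuple.
  apply: free_not0 (basis_free phi_basis) _; rewrite phiE mem_nth //.
  by rewrite size_tuple.
pose rl l := complex.Re (lam l).
have lamE (A_sym : A^T = A) l : lam l = real_complex R (rl l).
  exact: symmetric_eigenvalue_real A_sym (phi_eigen l) (phi_neq0 l).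
have rl_le (A_sym : A^T = A) l : `|lam l| <= real_complex R `|rl ord0|.
  by rewrite -normr_real_complex -lamE.
have rl0_neq0 (A_sym : A^T = A) : rl ord0 != 0.
  by apply: contra_neq lam0_neq0 => rl0; rewrite lamE // rl0.
have beta_bounds (A_sym : A^T = A) k : 0 <= beta k < rl ord0 ^+ 2 / 4.
  rewrite -(real_normK (num_real (rl ord0))).
  apply: (run_beta_bounds k A_sym phi_basis phi_eigen _ (rl_le A_sym) run) => //.
  by rewrite normr_gt0 rl0_neq0.
split=> [A_sym k|j j_gt0|A_sym].
- have -> : lam ord0 ^+ 2 / 4 = real_complex R (rl ord0 ^+ 2 / 4).
    by rewrite lamE // rmorphM rmorphXn fmorphV rmorph_nat.
  by rewrite ltcR; case/andP: (beta_bounds A_sym k).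
- have [S_adm T_adm] := expansion_indices_admissible j.
  exists (fun i => [seq kp <- (expansion_indices j).1 | size kp.2 == i]).
  exists (fun i => [seq kp <- (expansion_indices j).2 | size kp.2 == i]); split.
  + move=> i _; rewrite all_filter; apply: sub_all S_adm => kp /andP[kp_adm _].
    by apply/implyP => /eqP <-.
  + move=> i _; rewrite all_filter; apply: sub_all T_adm => kp /andP[kp_adm _].
    by apply/implyP => /eqP <-.
  rewrite (augmented_prod_dominant_expansion j phi_eigen u0_expansion (dm_beta0 run)
    mu_selected lam0_neq0 a1_neq0).
  rewrite -!sum_by_size; first last.
  + by apply: sub_all S_adm => kp /andP[].
  + by apply: sub_all T_adm => kp /andP[].
  do 2!congr (_ + _).
  rewrite /Mprod /Dprod big_nil scale1r /index_iota subSS subn0.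
  congr (_ *: (_ + _)); apply: eq_bigr => l _.
  by rewrite big_nil mulr1.
have phi_eigen_real l : complexify A *m phi l = real_complex R (rl l) *: phi l.
  by rewrite -lamE.
have rl_lt l : l != ord0 -> `|rl l| < `|rl ord0|.
  by move=> /lam_lt; rewrite !lamE // !normr_real_complex ltcR.
have beta_le k : 0 <= beta k <= rl ord0 ^+ 2 / 4.
  by case/andP: (beta_bounds A_sym k) => -> /ltW.
have [c [g [xE phi0_g g_cvg0]]] := run_error_cvg0 A_sym phi_eigen_real
  (phi_neq0 ord0) rl_lt u0_expansion a1_neq0 run h_neq0 (rl0_neq0 A_sym) beta_le.
have x_unit k : edot (x k.+1) (x k.+1) = 1 by apply: run_unit run _.
have sqrt_cvg0 (f : nat -> R) : f @ \oo --> (0 : R) ->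
    (fun k => Num.sqrt (f k)) @ \oo --> (0 : R).
  move=> f_cvg0; rewrite -[X in _ --> X](sqrtr0 R).
  by apply: continuous_cvg f_cvg0; apply: sqrt_continuous.
split.
  rewrite -(cvg_shiftS (fun k => line_dist (complexify (x k)) (phi ord0))).
  under eq_fun => k.
    have x_unit' : hnorm2 (complexify (x k.+1)) = 1.
      by rewrite /hnorm2 hdot_complexify x_unit.
    rewrite (line_dist_orthogonal (xE k) (phi_neq0 ord0) (phi0_g k) x_unit').
    over.
  exact: sqrt_cvg0 g_cvg0.
rewrite -(cvg_shiftS (fun k =>
  ComplexField.Normc.normc (real_complex R (nu k) - lam ord0))).
have err_cvg0 : (fun k => Num.sqrt (4 * `|rl ord0| ^+ 2 * hnorm2 (g k))) @ \oo
    --> (0 : R).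
  apply: sqrt_cvg0; rewrite -[X in _ --> X](mulr0 (4 * `|rl ord0| ^+ 2)).
  exact: cvgMl_tmp g_cvg0.
apply: squeeze_cvgr (cvg_cst (0 : R)) err_cvg0.
apply: nearW => k; rewrite normc_ge0 /=.
rewrite -[leLHS]ger0_norm ?normc_ge0 // -sqrtr_sqr ler_wsqrtr //.
rewrite (dm_nu run) (dm_v run).
exact: rayleigh_error A_sym phi_basis phi_eigen (rl_le A_sym) (xE k) (x_unit k).
Qed.
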